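(* Let $p>q>0$ with $p+q=1$, and let $S=S_1S_2S_3\ldots$ be an infinite string of independent, identically distributed letters from $\{a,b\}$ with $\mathbb{P}(S_j=a)=p$, $\mathbb{P}(S_j=b)=q$. For integers $n,k\ge 1$ let $X_{n,k}$ be the number of internal nodes at level $k$ of the suffix tree built from the first $n$ suffixes of $S$, i.e. the number of words $u\in\{a,b\}^k$ that occur at least twice as a factor of $S_1S_2\cdots S_{n+k-1}$. Let $k=k(n)$ satisfy $k=\alpha\log n$ (natural logarithm) for a constant $\alpha$, and put $\alpha_1=-1/\log q$. If $\alpha<\alpha_1$, then there exists $B>0$ such that $$\operatorname{Var}(X_{n,k})=O\big(e^{-n^{B}}\big)\qquad (n\to\infty).$$
   Context: Equivalently, $X_{n,k}=\sum_{u\in\{a,b\}^k} I_{n,u}$, where $I_{n,u}=1$ if at least two of the suffixes $S^{(j)}=S_jS_{j+1}\ldots$, $1\le j\le n$, have $u$ as a prefix, and $I_{n,u}=0$ otherwise. The paper assumes $k/\log n\to\alpha$ and then works with $k=\alpha\log n$. *)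

(* Defs.v *)
From HB Require Import structures.
From mathcomp Require Import all_boot all_order all_algebra.
From mathcomp Require Import finmap.
From mathcomp Require Import all_classical all_reals all_analysis measurable_realfun.

Set Implicit Arguments.
Unset Strict Implicit.
Unset Printing Implicit Defensive.

Import Order.TTheory GRing.Theory Num.Theory.
Import numFieldNormedType.Exports.

Local Open Scope classical_set_scope.
Local Open Scope ring_scope.

Definition mutually_independent (d d' : measure_display) (T : measurableType d)
    (E : measurableType d') (R : realType) (P : probability T R)
    (S : nat -> T -> E) : Prop :=
  forall (J : {fset nat}) (A : nat -> set E),
    (forall j, j \in J -> measurable (A j)) ->
    P (\bigcap_(j in [set` J]) (S j @^-1` A j)) =
      (\prod_(j <- J) P (S j @^-1` A j))%E.

(* The alphabet {a, b} is encoded by bool: a is true, b is false. Strings are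
   indexed from 0, so S j stands for the letter S_{j+1}. *)
Definition iid_letters (d : measure_display) (T : measurableType d)
    (R : realType) (P : probability T R) (p q : R)
    (S : nat -> {RV P >-> bool}) : Prop :=
  mutually_independent P (fun j => S j : T -> bool) /\
  forall j, P (S j @^-1` [set true]) = p%:E /\
            P (S j @^-1` [set false]) = q%:E.

(* u is a prefix of the suffix s_j s_{j+1} s_{j+2} ... of s *)
Definition prefix_at (s : nat -> bool) (k : nat) (u : k.-tuple bool) (j : nat)
    : bool :=
  [forall i : 'I_k, s (j + i)%N == tnth u i].

Definition occurrences (s : nat -> bool) (n k : nat) (u : k.-tuple bool)
    : nat :=
  #|[set j : 'I_n | prefix_at s u j]%SET|.

(* Number of internal nodes at level k of the suffix tree on the first n suffixes
   of s: a word of length k labels an internal node iff it is a prefix of at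
   least two of these suffixes, i.e. occurs at least twice as a factor of the
   first n + k - 1 letters of s. *)
Definition internal_nodes (s : nat -> bool) (n k : nat) : nat :=
  #|[set u : k.-tuple bool | (2 <= occurrences s n u)%N]%SET|.

Definition Xnk (d : measure_display) (T : measurableType d) (R : realType)
    (P : probability T R) (S : nat -> {RV P >-> bool}) (n k : nat) : T -> R :=
  fun w => (internal_nodes (fun j => S j w) n k)%:R.

Definition alpha1 (R : realType) (q : R) : R := - 1 / ln q.

Lemma measurable_Xnk (d : measure_display) (T : measurableType d)
    (R : realType) (P : probability T R) (S : nat -> {RV P >-> bool})
    (n k : nat) : measurable_fun setT (Xnk S n k).
Proof.
have mb (u : k.-tuple bool) (j : nat) :
    measurable_fun setT (fun w => prefix_at (fun i => S i w) u j).
  apply: (@measurable_fun_bool _ _ _ _ true) => //.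
  rewrite setTI (_ : _ @^-1` _ = \bigcap_(i : 'I_k) (S (j + i)%N @^-1` [set tnth u i])).
    apply: fin_bigcap_measurable => // i _.
    by rewrite -[X in measurable X]setTI; apply: measurable_funPT.
  apply/seteqP; split=> w /=.
    by move=> /forallP h i _; exact/eqP/h.
  by move=> h; apply/forallP => i; apply/eqP/h.
have mo (u : k.-tuple bool) : measurable_fun setT
    (fun w => (occurrences (fun i => S i w) n u)%:R : R).
  rewrite (_ : (fun w => _) = (fun w =>
    \sum_(j < n) (if prefix_at (fun i => S i w) u j then 1 else 0 : R))).
    by apply: measurable_sum => j; apply: measurable_fun_ifT => //; exact: mb.
  apply/funext => w; rewrite /occurrences -sum1_card natr_sum big_mkcond /=.
  by apply: eq_bigr => j _; rewrite inE.
rewrite (_ : Xnk S n k = (fun w => \sum_(u : k.-tuple bool)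
   (if (2%:R <= ((occurrences (fun i => S i w) n u)%:R : R)) then 1 else 0 : R))).
  apply: measurable_sum => u; apply: measurable_fun_ifT => //.
  apply: (@measurable_fun_bool _ _ _ _ true) => //.
  by apply: measurable_fun_le.
apply/funext => w; rewrite /Xnk /internal_nodes -sum1_card natr_sum big_mkcond.
by apply: eq_bigr => u _; rewrite inE ler_nat.
Qed.

(* Hence [fine 'V_P[Xnk S n k]] loses no information. *)
Lemma variance_Xnk_fin_num (d : measure_display) (T : measurableType d)
    (R : realType) (P : probability T R) (S : nat -> {RV P >-> bool})
    (n k : nat) : ('V_P[Xnk S n k] \is a fin_num)%E.
Proof.
rewrite /variance covariance.unlock unlock integrable_fin_num//.
set c := fine _.
apply: measurable_bounded_integrable => //.
- by rewrite -ge0_fin_numE// fin_num_measure.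
- have mX : measurable_fun setT (Xnk S n k \- cst c).
    by apply: measurable_funB => //; exact: measurable_Xnk.
  exact: measurable_funM.
pose M : R := (#|{: k.-tuple bool}|)%:R + `|c|.
have leM w : `|Xnk S n k w - c| <= M.
  rewrite (le_trans (ler_normB _ _))// lerD2r ger0_norm ?ler0n//.
  by rewrite ler_nat max_card.
exists (M * M); split; first by rewrite realM ?ger0_real ?(le_trans _ (leM point)).
move=> y ltMy w _ /=; rewrite normrM (le_trans _ (ltW ltMy))//.
by rewrite ler_pM ?normr_ge0 ?leM.
Qed.

(* Main.v *)
(** Since [alpha < alpha1 q], even the least likely word of length [k], which
    has probability [q ^+ k], is expected at least a positive power of [n] times
    among the first [n] positions.  Cut the string into disjoint blocks of
    length [k] and take two groups of [m = n %/ (2 * k)] blocks each: a word that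
    occurs fewer than twice is missed by all blocks of one group, which has
    probability at most [(1 - q ^+ k) ^+ m <= expR (- (m%:R * q ^+ k))].  Hence
    [Xnk] equals the constant [2 ^+ k] off an event of stretched-exponentially
    small probability, and the variance is at most [4 ^+ k] times that
    probability. *)

Require Import Defs.
From HB Require Import structures.
From mathcomp Require Import all_boot all_order all_algebra.
From mathcomp Require Import finmap.
From mathcomp Require Import all_classical all_reals all_analysis.
From mathcomp Require Import measurable_realfun.
From mathcomp Require Import ring lra.

Import Order.TTheory GRing.Theory Num.Theory.
Import numFieldNormedType.Exports.

Local Open Scope classical_set_scope.
Local Open Scope ring_scope.

(** * Words and disjoint blocks of a string *)

Definition spells (x : nat -> bool) (a : nat) (s : seq bool) : bool :=
  [seq x i | i <- iota a (size s)] == s.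

(** Only starts spaced by [size u] are tested, so the tested blocks are disjoint. The recursion
    peels off the last block, as the induction on [m] for the probabilities requires. *)
Fixpoint avoids (x : nat -> bool) (u : seq bool) (b m : nat) : bool :=
  if m is m'.+1 then avoids x u b m' && ~~ spells x (b + m' * size u) u
  else true.

Lemma spells_cat x a s t :
  spells x a (s ++ t) = spells x a s && spells x (a + size s) t.
Proof.
by rewrite /spells size_cat iotaD map_cat eqseq_cat// size_map size_iota.
Qed.

Lemma spellsP x a s :
  reflect (forall i, (i < size s)%N -> x (a + i)%N = nth false s i)
          (spells x a s).
Proof.
apply: (iffP eqP) => [h i lis|h].
  by rewrite -[in RHS]h (nth_map 0%N) ?size_iota// nth_iota.
apply: (@eq_from_nth _ false); first by rewrite size_map size_iota.
move=> i; rewrite size_map size_iota => lis.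
by rewrite (nth_map 0%N) ?size_iota// nth_iota// h.
Qed.

Lemma prefix_at_spells x k (u : k.-tuple bool) j :
  prefix_at x u j = spells x j u.
Proof.
apply/forallP/spellsP => [h i|h i].
  rewrite size_tuple => lik.
  by rewrite (eqP (h (Ordinal lik))) (tnth_nth false).
by rewrite h ?size_tuple// (tnth_nth false).
Qed.

Lemma avoidsPn x u b m :
  ~~ avoids x u b m ->
  exists2 i, (i < m)%N & spells x (b + i * size u) u.
Proof.
elim: m => //= m IH; rewrite negb_and negbK => /orP[/IH[i lim h]|h].
  by exists i => //; exact: ltnW.
by exists m.
Qed.

(** A group that does not avoid [u] contains an occurrence. One from the first group starts before
    [m * k] and one from the second does not, so the two starts differ; both lie below [n]. *)
Lemma occurrences_lt2_avoids x n k (u : k.-tuple bool) m :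
  (0 < k)%N -> (m * 2 * k <= n)%N -> (occurrences x n u < 2)%N ->
  avoids x u 0 m || avoids x u (m * k) m.
Proof.
move=> k0 mn; apply: contraTT; rewrite negb_or -leqNgt => /andP[].
move=> /avoidsPn[i1 li1 s1] /avoidsPn[i2 li2 s2].
rewrite size_tuple add0n in s1; rewrite size_tuple in s2.
have h1 : (i1 * k < m * k)%N by rewrite ltn_pmul2r.
have h2 : (m * k + i2 * k < n)%N.
  by apply: leq_trans mn; rewrite muln2 -addnn mulnDl ltn_add2l ltn_pmul2r.
have h1n : (i1 * k < n)%N by apply: (ltn_trans _ h2); rewrite ltn_addr.
pose j1 := Ordinal h1n; pose j2 := Ordinal h2.
have j12 : j1 != j2 by rewrite -val_eqE /= ltn_eqF// ltn_addr.
(* [2] becomes the cardinal of [[set j1; j2]], which [cards2] computes as [(j1 != j2).+1]. *)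
rewrite /occurrences -[2%N]/(true.+1) -j12 -cards2.
apply/subset_leq_card/fintype.subsetP => j.
rewrite !inE => /orP[] /eqP->; rewrite prefix_at_spells/=.
  exact: s1.
exact: s2.
Qed.

(** * Probabilities of spelling and of avoiding a word *)

Section letters.
Context {R : realType} {d : measure_display} {T : measurableType d}.
Context {P : probability T R} {p q : R} {S : nat -> {RV P >-> bool}}.

Definition event (Q : (nat -> bool) -> bool) : set T :=
  [set w | Q (fun j => S j w)].

Definition weight (s : seq bool) : R := \prod_(c <- s) (if c then p else q).

Lemma measurable_letter j (A : set bool) : measurable (S j @^-1` A).
Proof. by rewrite -[X in measurable X]setTI; exact: measurable_funPT. Qed.

Lemma measurable_spells a s : measurable (event (fun x => spells x a s)).
Proof.
elim: s a => [|c s IH] a.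
  rewrite (_ : event _ = setT); first exact: measurableT.
  by apply/seteqP; split => // w _ /=; apply/eqP.
rewrite (_ : event _ = S a @^-1` [set c] `&` event (fun x => spells x a.+1 s)).
  by apply: measurableI => //; exact: measurable_letter.
apply/seteqP; split => w /=; rewrite /event/= /spells/= eqseq_cons.
  by move=> /andP[/eqP -> ->].
by move=> [-> ->]; rewrite eqxx.
Qed.

Lemma measurable_avoids u b m : measurable (event (fun x => avoids x u b m)).
Proof.
elim: m => [|m IH] /=.
  rewrite (_ : event _ = setT); first exact: measurableT.
  by apply/seteqP; split.
rewrite (_ : event _ = event (fun x => avoids x u b m) `\`
   event (fun x => spells x (b + m * size u) u)).
  by apply: measurableD => //; exact: measurable_spells.
apply/seteqP; split => w /=; rewrite /event/=.
  by move=> /andP[-> /negP].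
by move=> [-> /negP ->].
Qed.

Hypothesis hS : iid_letters p q S.

Lemma prob_spells a s : P (event (fun x => spells x a s)) = (weight s)%:E.
Proof.
have [ind lett] := hS.
pose J := seq_fset tt (iota a (size s)).
(* The truncated subtraction is harmless, since every position in [J] is at least [a]. *)
pose A j : set bool := [set nth false s (j - a)].
have memJ j : (j \in J) = (a <= j < a + size s)%N.
  by rewrite seq_fsetE mem_iota.
rewrite (_ : event _ = \bigcap_(j in [set` J]) (S j @^-1` A j)); last first.
  apply/seteqP; split => w /=.
    move=> /spellsP h j /=; rewrite memJ => /andP[aj js].
    by rewrite /A/= -h ?subnKC// ltn_subLR.
  move=> h; apply/spellsP => i lis.
  by have := h (a + i)%N; rewrite /A/= memJ leq_addr ltn_add2l addKn; apply.
rewrite ind// (perm_big _ (seq_fset_perm _ _)) undup_id ?iota_uniq//.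
rewrite /weight -prodEFin (big_nth false) -{1}[a]addn0 iotaDl big_map.
rewrite /index_iota subn0; apply: eq_bigr => i _; rewrite /A addKn.
by case: (nth _ _ _); have [] := lett (a + i)%N.
Qed.

Hypothesis hpq : p + q = 1.

(** Split on the letter just before the word: the two longer words have weights [p * weight s] and
    [q * weight s], which add up to [weight s]. This allows a whole block to be left free. *)
Lemma prob_spells_gap (A : set T) (r : R) (c : nat) : measurable A ->
  (forall s, P (A `&` event (fun x => spells x c s)) = (r * weight s)%:E) ->
  forall g s,
    P (A `&` event (fun x => spells x (c + g) s)) = (r * weight s)%:E.
Proof.
move=> mA h; elim=> [|g IH] s; first by rewrite addn0.
pose E l := A `&` event (fun x => spells x (c + g) (l :: s)).
have mE l : measurable (E l).
  by apply: measurableI => //; exact: measurable_spells.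
rewrite (_ : _ `&` _ = E true `|` E false); last first.
  apply/seteqP; split => w; rewrite /E /event/= /spells/= addnS.
    move=> [Aw sw]; case Sw: (S (c + g)%N w); [left|right]; split => //;
      by rewrite eqseq_cons sw.
  by move=> [[Aw]|[Aw]]; rewrite eqseq_cons => /andP[_ ->].
rewrite measureU//; last first.
  apply/seteqP; split => // w; rewrite /E /event/= /spells/=.
  by rewrite !eqseq_cons => -[[_ /andP[/eqP -> _]] [_ /andP[]]].
rewrite /= /E !IH /weight !big_cons -EFinD; congr EFin.
by rewrite -mulrDr -mulrDl hpq mul1r.
Qed.

(* The last block spells [u] on an event that only lengthens the word spelled
   after the earlier blocks, so the induction stays within events of this
   form and independence of single letters suffices. *)
Lemma prob_avoids_spells u b m s :
  P (event (fun x => avoids x u b m) `&`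
     event (fun x => spells x (b + m * size u) s)) =
  ((1 - weight u) ^+ m * weight s)%:E.
Proof.
elim: m s => [|m IH] s.
  rewrite /= (_ : event _ = setT); last by apply/seteqP; split.
  by rewrite setTI mul0n addn0 expr0 mul1r prob_spells.
pose A := event (fun x => avoids x u b m).
pose V := event (fun x => spells x (b + m.+1 * size u) s).
pose UV := event (fun x => spells x (b + m * size u) (u ++ s)).
have mA : measurable A by exact: measurable_avoids.
have mV : measurable V by exact: measurable_spells.
have mUV : measurable UV by exact: measurable_spells.
rewrite (_ : event _ `&` _ = (A `&` V) `\` (A `&` UV)); last first.
  apply/seteqP; split => w; rewrite /A /UV /V /event/= spells_cat mulSn
    (addnC (size u)) addnA.
    by move=> [/andP[-> /negP hu] ->]; split=> // -[_ /andP[]].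
  move=> [[-> ->]] h; split => //=; apply/negP => hu.
  by apply: h; split => //; rewrite hu.
rewrite measureD; [|exact: measurableI..|]; last first.
  by rewrite (le_lt_trans (probability_le1 _ _)) ?ltry//; exact: measurableI.
rewrite (_ : A `&` V `&` _ = A `&` UV); last first.
  apply/seteqP; split => w; rewrite /A /UV /V /event/=; first by case.
  rewrite spells_cat => -[-> /andP[-> h]]; split => //; split => //.
  by rewrite mulSn (addnC (size u)) addnA.
(* The subtracted term is the induction hypothesis for [u ++ s]; the other term leaves the last
   block free, a gap of [size u] letters. *)
rewrite /= IH /V mulSn (addnC (size u)) addnA (prob_spells_gap _ _ _ mA IH).
rewrite /weight big_cat/= -EFinB; congr EFin.
by rewrite exprS; ring.
Qed.

Lemma prob_avoids u b m :
  P (event (fun x => avoids x u b m)) = ((1 - weight u) ^+ m)%:E.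
Proof.
have := prob_avoids_spells u b m [::].
rewrite {2}/weight big_nil mulr1 => <-; congr (P _).
by apply/seteqP; split => [w h|w []//]; split => //; apply/eqP.
Qed.

Hypotheses (hq : 0 < q) (hqp : q < p).

Lemma weight_ge s : q ^+ size s <= weight s.
Proof.
elim: s => [|c s IH]; first by rewrite /weight big_nil expr0.
rewrite /weight big_cons exprS; apply: ler_pM => //.
- exact: ltW.
- exact/exprn_ge0/ltW.
- by case: c => //; exact: ltW.
Qed.

Lemma weight_le1 s : weight s <= 1.
Proof.
elim: s => [|c s IH]; first by rewrite /weight big_nil.
have [p0 p1] : 0 <= p /\ p <= 1 by move: hq hqp hpq => *; split; lra.
have q1 : q <= 1 by move: hqp hpq => *; lra.
rewrite /weight big_cons; apply: mulr_ile1 => //.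
- by case: c => //; exact: ltW.
- exact: le_trans (exprn_ge0 _ (ltW hq)) (weight_ge s).
- by case: c.
Qed.

Lemma prob_avoids_le u b m :
  (P (event (fun x => avoids x u b m)) <=
   (expR (- (m%:R * q ^+ size u)))%:E)%E.
Proof.
rewrite prob_avoids lee_fin mulrC -mulNr expRM_natr.
(* By [weight_le1] the base [1 - weight u] is nonnegative, so it suffices to compare bases: [1 -
   weight u <= 1 - q ^+ size u <= expR (- q ^+ size u)]. *)
rewrite lerXn2r ?nnegrE ?subr_ge0 ?weight_le1 ?expR_ge0//.
rewrite (le_trans _ (expR_ge1Dx _))// lerD2l lerN2.
exact: weight_ge.
Qed.

End letters.

(** * Variance of a bounded variable that is constant off a small event *)

Section variance_bound.
Context {R : realType} {d : measure_display} {T : measurableType d}.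
Context {P : probability T R}.

(** Supplies the square integrability that the variance identities below require; total mass [1]
    makes the integral of the constant bound finite. *)
Lemma bounded_Lfun2 (X : T -> R) (M : R) :
  measurable_fun setT X -> (forall w, `|X w| <= M) -> X \in Lfun P 2%:E.
Proof.
move=> mX XM; rewrite inE; apply/andP; split; rewrite inE//=.
rewrite /finite_norm unlock /=; apply: poweR_lty.
have M0 : 0 <= M by exact: le_trans (normr_ge0 _) (XM point).
apply: (@le_lt_trans _ _ (\int[P]_x (cst (M `^ 2)%:E) x)%E).
  apply: ge0_le_integral => //.
  - apply/measurable_EFinP.
    apply: (@measurableT_comp _ _ _ _ _ _ (fun x : R => x `^ 2)) => //.
    exact: measurableT_comp.
  - by move=> w _; rewrite lee_fin ge0_ler_powR ?nnegrE.
by rewrite integral_cst//= probability_setT mule1 ltry.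
Qed.

(** The variance is unchanged by subtracting [c], hence at most the second moment of [X - c], whose
    integrand is at most [M ^+ 2] times the indicator of [G]. *)
Lemma variance_le_deviation (X : T -> R) (c M : R) (G : set T) :
  measurable_fun setT X -> measurable G -> (forall w, `|X w - c| <= M) ->
  (forall w, ~ G w -> X w = c) -> ('V_P[X] <= (M ^+ 2)%:E * P G)%E.
Proof.
move=> mX mG XM XG.
have M0 : 0 <= M by exact: le_trans (normr_ge0 _) (XM point).
have mY : measurable_fun setT (X \- cst c) by exact: measurable_funB.
have X2 : X \in Lfun P 2%:E.
  apply: (@bounded_Lfun2 _ (M + `|c|)) => // w.
  by rewrite -[X w](subrK c) (le_trans (ler_normD _ _))// lerD2r.
have Y2 : (X \- cst c)%R \in Lfun P 2%:E by exact: (@bounded_Lfun2 _ M).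
rewrite -(varianceB_cst_r c X2) varianceE//.
apply: (@le_trans _ _ 'E_P[(fun w => (X w - c) ^+ 2)%R]%E).
  rewrite -[Y in (_ <= 'E_P[Y])%E]/((X \- cst c) ^+ 2).
  by rewrite leeBlDr ?leeDl ?sqre_ge0 ?fin_numX
    ?expectation_fin_num ?Lfun_subset12 ?fin_num_measure.
rewrite -(expectation_indic P mG) -expectationZl; last first.
  by apply/Lfun1_integrable; exact: integrable_indic.
apply: expectation_le.
- exact: measurable_funX.
- by apply: measurable_funM.
- by move=> w; exact: sqr_ge0.
- by move=> w /=; rewrite mulr_ge0 ?sqr_ge0.
apply: aeW => w /=; rewrite indicE.
have [wG|wG] := pselect (G w); last first.
  by rewrite XG// subrr expr0n memNset// mul0r.
rewrite mem_set// mul1r.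
by rewrite -real_normK ?num_real// lerXn2r ?nnegrE.
Qed.

End variance_bound.

(** * The union bound over words, and the estimate for large [n] *)

Lemma probability_bigsetU_le (R : realType) (d : measure_display)
    (T : measurableType d) (P : probability T R) (I : finType)
    (A : I -> set T) (r : R) :
  (forall i, measurable (A i)) -> (forall i, P (A i) <= r%:E)%E ->
  (P (\big[setU/set0]_i A i) <= (#|I|%:R * r)%:E)%E.
Proof.
move=> mA Ar; rewrite -sum1_card natr_sum mulr_suml.
(* Measurability is carried along the induction because subadditivity asks for it at each union. *)
suff [] : measurable (\big[setU/set0]_i A i) /\
  (P (\big[setU/set0]_i A i) <= (\sum_(i : I) 1 * r)%:E)%E by [].
apply: (big_rec2 (fun B x => measurable B /\ (P B <= x%:E)%E)).
  by split; [exact: measurable0|rewrite measure0].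
move=> i B x _ [mB Bx]; split; first exact: measurableU.
apply: (le_trans (measureU2 P (mA i) mB)).
by rewrite mul1r EFinD; apply: leeD => /=.
Qed.

(** The factor [2 * 8 ^+ k] collects [4 ^+ k] from the squared deviation, [2 ^+ k] from the union
    over words, and [2] from the two groups of blocks. *)
Lemma variance_Xnk_le (R : realType) (d : measure_display)
    (T : measurableType d) (P : probability T R) (p q : R)
    (S : nat -> {RV P >-> bool}) (n k m : nat) :
  iid_letters p q S -> p + q = 1 -> 0 < q -> q < p ->
  (0 < k)%N -> (m * 2 * k <= n)%N ->
  fine 'V_P[Xnk S n k] <= 2 * 8 ^+ k * expR (- (m%:R * q ^+ k)).
Proof.
move=> hS hpq hq hqp k0 mn.
pose N : R := 2 ^+ k.
have cardN : #|{: k.-tuple bool}|%:R = N by rewrite card_tuple card_bool natrX.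
pose e : R := expR (- (m%:R * q ^+ k)).
pose av b (u : k.-tuple bool) : set T :=
  event (S := S) (fun x => avoids x u b m).
pose A u := av 0%N u `|` av (m * k)%N u.
have mav b u : measurable (av b u) by exact: measurable_avoids.
have mA u : measurable (A u) by exact: measurableU.
have avle b u : (P (av b u) <= e%:E)%E.
  have := prob_avoids_le hS hpq hq hqp u b m.
  by rewrite size_tuple.
have Ale u : (P (A u) <= (e + e)%:E)%E.
  apply: (le_trans (measureU2 P (mav _ u) (mav _ u))).
  by rewrite EFinD; apply: leeD => /=.
pose G := \big[setU/set0]_(u : k.-tuple bool) A u.
have mG : measurable G by exact: bigsetU_measurable.
have GN w : ~ G w -> Xnk S n k w = N.
  move=> nG; rewrite /Xnk -cardN; congr (_%:R).
  rewrite /internal_nodes -cardsT; congr #|pred_of_set _|; apply/setP => u.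
  rewrite !inE leqNgt; apply/negP.
  move=> /(occurrences_lt2_avoids _ _ _ _ _ k0 mn) h.
  apply: nG; rewrite /G (bigD1 u)//=; left.
  by case/orP: h; [left|right].
have XN w : `|Xnk S n k w - N| <= N.
  rewrite ler_norml; apply/andP; split.
    by rewrite lerBrDr addNr ler0n.
  rewrite lerBlDr (@le_trans _ _ N)// ?lerDl ?exprn_ge0//.
  by rewrite -cardN ler_nat max_card.
rewrite -lee_fin fineK ?variance_Xnk_fin_num//.
have mX := measurable_Xnk S n k.
apply: (le_trans (variance_le_deviation _ _ _ _ mX mG XN GN)).
have PG := probability_bigsetU_le _ _ _ P _ A _ mA Ale.
apply: (@le_trans _ _ ((N ^+ 2)%:E * (N * (e + e))%:E)%E).
  by rewrite -cardN lee_wpmul2l// lee_fin sqr_ge0.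
rewrite -EFinM lee_fin /e -mulr2n -(mulr_natl (expR _)) !mulrA -exprSr.
have -> : 8 = 2 ^+ 3 :> R by rewrite -natrX.
by rewrite -exprM mulnC exprM (mulrC (2 : R)).
Qed.

(* With [y = n^delta], the choice of [delta] makes the expected number of
   occurrences of a word among the [n / 2k] blocks at least of order [y ^+ 2],
   while [k] is at most of order [y]. *)
Lemma block_count_bound (R : realType) (q a delta : R) (n k : nat) :
  0 < q -> q < 1 -> 0 < a -> 0 < delta -> 1 + a * ln q = 3 * delta ->
  (1 < n)%N -> (0 < k)%N -> k%:R <= a * ln n%:R ->
  3 + 3 * a / delta <= delta / (2 * a) * n%:R `^ delta ->
  exists2 m, (m * 2 * k <= n)%N &
    2 * 8 ^+ k * expR (- (m%:R * q ^+ k)) <= expR (- (n%:R `^ delta)).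
Proof.
move=> q0 q1 a0 d0 hd n1 k0 ka.
set L := ln n%:R in ka *; set y := n%:R `^ delta => hy.
have n0 : (0 : R) < n%:R by rewrite ltr0n ltnW.
have L0 : 0 < L by rewrite ln_gt0// ltr1n.
have yE : y = expR (delta * L) by rewrite /y /powR gt_eqF.
have y1 : 1 <= y by rewrite yE -expR0 ler_expR mulr_ge0// ltW.
have y0 : 0 < y by rewrite yE expR_gt0.
(* A logarithm is dominated by a power: [delta * L <= expR (delta * L) = y]. *)
have Ly : L <= y / delta.
  rewrite ler_pdivlMr// mulrC yE (le_trans _ (expR_ge1Dx _))//.
  by rewrite lerDr.
have k0R : (0 : R) < k%:R by rewrite ltr0n.
(* The largest [m] for which two groups of [m] blocks of length [k] fit into [n] positions; rounding
   down loses less than one block. *)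
exists (n %/ (2 * k))%N; first by rewrite -mulnA leq_trunc_div.
set m := (n %/ _)%N.
have hm : n%:R / (2 * k%:R) - 1 <= m%:R :> R.
  rewrite lerBlDr ler_pdivrMr ?mulr_gt0// -natrM natr1 -natrM ler_nat.
  by rewrite ltnW// ltn_ceil// muln_gt0.
have qk0 : 0 < q ^+ k by exact: exprn_gt0.
have qk1 : q ^+ k <= 1 by rewrite exprn_ile1// ltW.
have cy : delta / (2 * a) * y ^+ 2 <= n%:R * q ^+ k / (2 * k%:R).
  (* On the logarithmic scale, [3 * delta * L = L + a * L * ln q <= L + k * ln q], because
     [k <= a * L] and [ln q <= 0]. *)
  have nq : y ^+ 3 <= n%:R * q ^+ k.
    rewrite yE -expRM_natr -{1}[q]lnK ?posrE// -expRM_natr.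
    rewrite -[n%:R]lnK ?posrE// -expRD ler_expR -/L.
    have -> : delta * L * 3 = L + a * L * ln q.
      by rewrite mulrAC (mulrC delta) -hd; ring.
    by rewrite lerD2l mulrC; apply: ler_wnM2l => //; rewrite ln_le0// ltW.
  rewrite ler_pdivlMr ?mulr_gt0// (le_trans _ nq)//.
  (* One of the three factors [y] pays for the division by [k], which leaves [y ^+ 2]. *)
  have kd : k%:R * delta <= a * y.
    by rewrite -ler_pdivlMr// -mulrA (le_trans ka)// ler_pM2l.
  rewrite (_ : _ * (2 * _) = (k%:R * delta) * (y ^+ 2 / a));
    last by field; rewrite gt_eqF.
  rewrite (_ : y ^+ 3 = (a * y) * (y ^+ 2 / a));
    last by field; rewrite gt_eqF.
  by rewrite ler_wpM2r// mulr_ge0 ?sqr_ge0// invr_ge0 ltW.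
have mq : n%:R * q ^+ k / (2 * k%:R) - 1 <= m%:R * q ^+ k.
  rewrite (@le_trans _ _ ((n%:R / (2 * k%:R) - 1) * q ^+ k))//.
    by rewrite mulrBl mul1r mulrAC lerD2l lerN2.
  by rewrite ler_pM2r.
have e2 : 2 <= expR 1 :> R by rewrite (le_trans _ (expR_ge1Dx _)).
have e8 : 8 ^+ k <= expR (3 * k%:R) :> R.
  rewrite expRM_natr lerXn2r ?nnegrE ?expR_ge0//.
  have -> : 8 = 2 ^+ 3 :> R by rewrite -natrX.
  by rewrite -[3 in leRHS]mul1r expRM_natr lerXn2r ?nnegrE ?expR_ge0.
(* The prefactor moves into the exponent through [2 <= expR 1], which also gives [8 <= expR 3]. *)
apply: (@le_trans _ _ (expR 1 * expR (3 * k%:R) * expR (- (m%:R * q ^+ k)))).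
  by rewrite ler_pM2r ?expR_gt0// ler_pM// exprn_ge0.
rewrite -!expRD ler_expR.
have k3 : 3 * k%:R <= 3 * a / delta * y.
  by rewrite -!mulrA ler_pM2l// (le_trans ka)// ler_pM2l// mulrC.
(* With [c = delta / (2 * a)], the exponent is at most [2 + 3 * a / delta * y - c * y ^+ 2].
   Multiplying [hy] by [y] bounds this by [2 - 3 * y], which is at most [- y] since [1 <= y]. *)
have := ler_wpM2r (ltW y0) hy.
rewrite -[_ * y * y]mulrA -expr2 mulrDl.
move: y1 k3 mq cy; lra.
Qed.

Theorem theorem1 (R : realType) (d : measure_display) (T : measurableType d)
    (P : probability T R) (p q : R) (S : nat -> {RV P >-> bool})
    (k : nat -> nat) (alpha : R)
    (hq : 0 < q) (hqp : q < p) (hpq : p + q = 1)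
    (hS : iid_letters p q S)
    (hk1 : forall n, (1 <= n)%N -> (1 <= k n)%N)
    (hk : ((k n)%:R / ln n%:R : R) @[n --> \oo] --> alpha)
    (halpha : alpha < alpha1 q) :
  exists B : R, 0 < B /\
    (fun n : nat => fine 'V_P[Xnk S n (k n)] : R) =O_\oo
    (fun n : nat => expR (- (n%:R `^ B)) : R).
Proof.
have q1 : q < 1 by lra.
have lnq : ln q < 0 by rewrite ln_lt0// hq.
have alpha10 : 0 < alpha1 q by rewrite /alpha1 mulN1r oppr_gt0 invr_lt0.
(* The room between [alpha] and [a] turns the limit into [k n <= a * ln n] for large [n]. Taking the
   midpoint from [Num.max alpha 0] keeps [a] positive. *)
have [a [aa a0 a1]] : exists a, [/\ alpha < a, 0 < a & a < alpha1 q].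
  have [m0 m1] : 0 < alpha1 q - Num.max alpha 0 /\ Num.max alpha 0 < alpha1 q.
    by rewrite subr_gt0 gt_max halpha.
  exists ((Num.max alpha 0 + alpha1 q) / 2).
  have := le_max alpha alpha 0; have := le_max 0 alpha 0.
  rewrite !lexx orbT /= => h0 ha; split; lra.
(* Since [ln q < 0], the inequality [a < alpha1 q] says exactly that [1 + a * ln q] is positive; a
   third of it serves as the exponent [B]. *)
have [delta d0 hd] : exists2 delta, 0 < delta & 1 + a * ln q = 3 * delta.
  exists ((1 + a * ln q) / 3); last by field.
  by rewrite divr_gt0// -ltrBlDl sub0r -ltr_ndivlMr.
exists delta; split => //.
(* The threshold that [n%:R]^
   delta[must reach for the last hypothesis of]block_count_bound[; it is reached once]n[is at least]y0
   [^ delta^-1]. *)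
pose y0 : R := (delta / (2 * a))^-1 * (3 + 3 * a / delta).
have c0 : 0 < delta / (2 * a) by rewrite divr_gt0 ?mulr_gt0.
have y0_ge0 : 0 <= y0.
  by rewrite mulr_ge0 ?invr_ge0 ?addr_ge0 ?divr_ge0 ?mulr_ge0 ?ltW.
apply/eqO_exP; exists 1 => //.
have near_k : \forall n \near \oo, (k n)%:R / ln n%:R < a :> R.
  by move/cvgr_lt : hk; apply.
near=> n.
have n1 : (1 < n)%N by near: n; exact: nbhs_infty_gt.
have kn : (k n)%:R <= a * ln n%:R :> R.
  rewrite -ler_pdivrMr ?ln_gt0 ?ltr1n// ltW//.
  by near: n.
have yn : 3 + 3 * a / delta <= delta / (2 * a) * n%:R `^ delta.
  rewrite -ler_pdivrMl// -/y0.
  have -> : y0 = (y0 `^ delta^-1) `^ delta.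
    by rewrite -powRrM mulVf ?gt_eqF// powRr1.
  rewrite ge0_ler_powR ?nnegrE ?powR_ge0 ?(ltW d0)//.
  by near: n; exact: nbhs_infty_ger.
have [m mn hm] := block_count_bound _ _ _ _ _ _ hq q1 a0 d0 hd n1
  (hk1 _ (ltnW n1)) kn yn.
rewrite mul1r [leRHS]ger0_norm ?expR_ge0//.
rewrite ger0_norm ?fine_ge0 ?variance_ge0//.
apply: le_trans hm.
exact: (variance_Xnk_le _ _ _ _ _ _ _ _ _ _ hS hpq hq hqp (hk1 _ (ltnW n1)) mn).
Unshelve. all: by end_near. Qed.
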